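(* Consider the optimal control problem $\min j(y(T))$ subject to $\dot y=f(y,u)$, $y(0)=y_0$ on $[0,T]$, discretized on an equidistant grid $t_n=n\Delta t$, $N\Delta t=T$, by an $s$-stage linear multi-step method of BDF type of order $p$, i.e. with coefficients $a=(a_0,\dots,a_{s-1})$, $b=(b_{-1},b_0,\dots,b_{s-1})$ satisfying $b_k=0$ for all $k\ge 0$ and $b_{-1}\ne0$. Assume that $j(y(T))$ is approximated by $j(y_N)$. Then for $t<T$ the update formula for the adjoint variable obtained by discretize-then-optimize, namely $$0=p_i+(A^t\vec p)_i-\Delta t\,(B^t\vec p)_i\,f_y(y_i,u_i)+\partial_{y_i}j(y_N)\qquad (i<N),$$ and the update formula obtained by optimize-then-discretize, namely $$p_{n-1}=-\sum_{i=0}^{s-1}a_i\,p_{n+i}+\Delta t\sum_{i=-1}^{s-1}b_i\,f_y(y_{n+i-1},u_{n+i-1})\,p_{n+i}\qquad (n-1<N),$$ coincide up to $O(\Delta t^p)$. That is, identifying the updated index $i$ of the first formula with the updated index $n-1$ of the second and inserting the same discrete values $y_k,u_k,p_k$ in both, the two update formulas differ by a term of size $O(\Delta t^p)$ as $\Delta t\to0$.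
   Context: $f:\mathbb{R}^n\times\mathbb{R}^m\to\mathbb{R}^n$ and $j$ are smooth, and the optimal control problem is assumed to have a sufficiently regular solution $(y,u)$ with associated adjoint $p(\cdot)$ satisfying the first-order optimality conditions $\dot y=f(y,u)$, $-\dot p=f_y(y,u)^Tp$, $p(T)=j'(y(T))$, $f_u(y,u)^Tp=0$. The sequences $y_k\approx y(t_k)$, $u_k\approx u(t_k)$ are the discrete states and controls, $k=1-s,\dots,N$. The states are computed by the multi-step scheme $y_{n+1}=-\sum_{k=0}^{s-1}a_k y_{n-k}+\Delta t\sum_{k=-1}^{s-1}b_k f(y_{n-k},u_{n-k})$. A scheme is of order $p$ if $y(t_i)=y_i+O(\Delta t^p)$. The starting values are assumed consistent to the order of the scheme. (The letter $p$ in $O(\Delta t^p)$ is the order; $p_k$ denotes the discrete adjoint variables and $\vec p=(p_{1-s},\dots,p_N)$.) Here $(A^t\vec p)_i=\sum_{k=0}^{s-1}a_k\,p_{i+1+k}$ and $(B^t\vec p)_i=\sum_{k=-1}^{s-1}b_k\,p_{i+1+k}$. The first formula is the stationarity condition with respect to $y_i$ of the Lagrangian of the discretized control problem $\min j(y_N)$ subject to the multi-step scheme. The second is the same multi-step method applied, backward in time, to the continuous adjoint equation $-p'(t)=f_y(y(t),u(t))\,p(t)$. Transposes are suppressed: in the first formula $p_i$ is treated as a row vector, while in the second $f_y\,p$ stands for $f_y^Tp$ with $p$ a column vector, so the products $(\cdot)f_y$ and $f_y(\cdot)$ are identified by transposition. The formulas are considered for indices for which all occurring values are defined.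
   Formalization: As printed the claim fails for p≥3 (e.g. f=y², BDF3); proved: O(Δt^p) with f_y taken at (y_{n+i},u_{n+i}), and O(Δt^{min(p,2)}) for the printed formula, assuming the p_k bounded and u_k=u(t_k)+O(Δt). *)

(* Defs.v *)
From HB Require Import structures.
From mathcomp Require Import all_boot all_order all_algebra.
From mathcomp Require Import all_classical all_reals all_analysis.

Set Implicit Arguments.
Unset Strict Implicit.
Unset Printing Implicit Defensive.

Import Order.TTheory GRing.Theory Num.Theory.
Import numFieldNormedType.Exports.

Local Open Scope classical_set_scope.
Local Open Scope ring_scope.

(* C^oo: every iterated directional derivative exists and is differentiable.
   In finite dimension this is the usual notion. *)
Definition smooth (R : realType) (V W : normedModType R) (g : V -> W) : Prop :=
  forall (vs : seq V) (x : V),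
    differentiable (foldr (fun v h => 'D_v h) g vs) x.

Definition C1 (R : realType) (V : normedModType R) (g : R -> V) : Prop :=
  (forall t, derivable g t 1) /\ continuous (derive1 g).

Section Control.
Variables (R : realType) (n m : nat).
Implicit Types (f : 'cV[R]_n -> 'cV[R]_m -> 'cV[R]_n) (j : 'cV[R]_n -> R).

Definition gradient j (y : 'cV[R]_n) : 'cV[R]_n :=
  \col_l 'D_(delta_mx l 0) j y.

(* Jacobian matrices acting on columns: the (k, l) entry is the derivative of
   the k-th component in the l-th variable (mathcomp-analysis' [jacobian] is the
   transpose, since it acts on rows). *)
Definition f_y f (y : 'cV[R]_n) (u : 'cV[R]_m) : 'M[R]_n :=
  \matrix_(k, l) ('D_(delta_mx l 0) (fun z : 'cV[R]_n => f z u) y) k 0.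

Definition f_u f (y : 'cV[R]_n) (u : 'cV[R]_m) : 'M[R]_(n, m) :=
  \matrix_(k, l) ('D_(delta_mx l 0) (fun v : 'cV[R]_m => f y v) u) k 0.

Definition admissible f (T : R) (y0 : 'cV[R]_n)
    (y : R -> 'cV[R]_n) (u : R -> 'cV[R]_m) : Prop :=
  [/\ y 0 = y0,
      {within `[0, T], continuous y},
      {within `[0, T], continuous u} &
      forall t, 0 < t < T -> is_derive t 1 y (f (y t) (u t))].

Definition optimal f j (T : R) (y0 : 'cV[R]_n)
    (y : R -> 'cV[R]_n) (u : R -> 'cV[R]_m) : Prop :=
  admissible f T y0 y u /\
  forall z v, admissible f T y0 z v -> j (y T) <= j (z T).

(* First-order optimality conditions with adjoint [q]. *)
Definition adjoint_conditions f j (T : R)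
    (y : R -> 'cV[R]_n) (u : R -> 'cV[R]_m) (q : R -> 'cV[R]_n) : Prop :=
  [/\ {within `[0, T], continuous q},
      forall t, 0 < t < T ->
        is_derive t 1 q (- ((f_y f (y t) (u t))^T *m q t)),
      q T = gradient j (y T) &
      forall t, 0 <= t <= T -> (f_u f (y t) (u t))^T *m q t = 0].

End Control.

Section Multistep.
Variables (R : realType) (n m s : nat).
(* The index k of a_k runs over 0 .. s-1 and that of b_k over -1 .. s-1; other
   values of [a] and [b] are never used. Grid sequences are indexed by [int]
   because of the starting values with index 1-s .. 0. *)
Variables (a : nat -> R) (b : int -> R).
Implicit Types (f : 'cV[R]_n -> 'cV[R]_m -> 'cV[R]_n) (j : 'cV[R]_n -> R).
Implicit Types (y p : int -> 'cV[R]_n) (u : int -> 'cV[R]_m).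

Definition bdf_type : Prop :=
  (forall k : nat, (k < s)%N -> b k%:Z = 0) /\ b (-1) != 0.

Definition multistep f (dt : R) (N : nat) y u : Prop :=
  forall l : int, 0 <= l < N%:Z ->
    y (l + 1) =
      - (\sum_(k < s) a k *: y (l - k%:Z)) +
      dt *: \sum_(k < s.+1)
              b (k%:Z - 1) *: f (y (l - (k%:Z - 1))) (u (l - (k%:Z - 1))).

Definition At p (i : int) : 'cV[R]_n :=
  \sum_(k < s) a k *: p (i + 1 + k%:Z).

Definition Bt p (i : int) : 'cV[R]_n :=
  \sum_(k < s.+1) b (k%:Z - 1) *: p (i + 1 + (k%:Z - 1)).

(* The row vector of partial derivatives of j(y_N), as a function of the whole
   sequence y, with respect to the i-th element of that sequence. *)
Definition d_yi_jN j (N : nat) y (i : int) : 'rV[R]_n :=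
  \row_l 'D_(delta_mx l 0)
           (fun z : 'cV[R]_n => j ([eta y with i |-> z] N%:Z)) (y i).

(* Right-hand side of the discretize-then-optimize formula
   0 = p_i + (A^t p)_i - dt (B^t p)_i f_y(y_i, u_i) + d_{y_i} j(y_N). *)
Definition dto f j (dt : R) (N : nat) y u p (i : int) : 'rV[R]_n :=
  (p i)^T + (At p i)^T - dt *: ((Bt p i)^T *m f_y f (y i) (u i))
  + d_yi_jN j N y i.

(* Left-hand side minus right-hand side of the optimize-then-discretize formula
   p_{l-1} = - sum_i a_i p_{l+i}
             + dt sum_i b_i f_y(y_{l+i-d}, u_{l+i-d})^T p_{l+i}.
   For d = 0 the Jacobian is taken at the same grid point as p_{l+i}, as in the
   backward multi-step method for -p' = f_y^T p; for d = 1 it is taken one grid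
   point earlier. *)
Definition otd (d : int) f (dt : R) y u p (l : int) : 'cV[R]_n :=
  p (l - 1) -
  (- (\sum_(k < s) a k *: p (l + k%:Z)) +
   dt *: \sum_(k < s.+1)
           b (k%:Z - 1) *:
             ((f_y f (y (l + (k%:Z - 1) - d)) (u (l + (k%:Z - 1) - d)))^T
                *m p (l + (k%:Z - 1)))).

End Multistep.

(* Step size on the grid with N steps; dt -> 0 is N -> oo. *)
Definition step (R : realType) (T : R) (N : nat) : R := T / N%:R.

(* The family e N k is O(dt^q) as dt -> 0, uniformly over the indices k with
   lo <= k <= hi N. *)
Definition unifO (R : realType) (V : normedModType R) (T : R) (q : nat)
    (lo : int) (hi : nat -> int) (e : nat -> int -> V) : Prop :=
  exists C : R, \forall N \near \oo, forall k : int, lo <= k <= hi N ->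
    `|e N k| <= C * step T N ^+ q.

(* Main.v *)
Require Import Defs.
From HB Require Import structures.
From mathcomp Require Import all_boot all_order all_algebra.
From mathcomp Require Import all_classical all_reals all_analysis.
From mathcomp Require Import ring lra.
Import Order.TTheory GRing.Theory Num.Theory.
Import numFieldNormedType.Exports.
Local Open Scope classical_set_scope.
Local Open Scope ring_scope.

(** For a method of BDF type, (B^t p)_i reduces to its single term b_{-1} p_i,
    and j(y_N) does not depend on y_i when i < N.  After the index shift
    n - 1 = i the two update formulas therefore agree except for the grid point
    at which the Jacobian is evaluated ([dto_otd]): their difference is
<<
      dt b_{-1} (f_y(y_{i-d}, u_{i-d}) - f_y(y_i, u_i))^T p_i ,
>>
    where d = 0 if the backward method takes f_y at the grid point of the
    adjoint value that it multiplies, and d = 1 if it takes f_y one grid point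
    earlier.  For d = 0 the difference vanishes identically.

    For d = 1 it is O(dt^2): besides the explicit factor dt and the bounded
    p_i, the difference of the two Jacobians is O(dt) ([f_y_consecutive]).
    Indeed consecutive discrete values lie within O(dt) of the points
    (y(t_{i-1}), u(t_{i-1})) and (y(t_i), u(t_i)) of the continuous solution;
    these are O(dt) apart because y and u are C^1; and f_y is Lipschitz near the
    solution curve.  For the last point, smoothness of f makes f_y locally
    Lipschitz by the mean value inequality ([f_y_locally_lipschitz]), and
    compactness of the time interval makes the Lipschitz constant and the radius
    of validity uniform along the curve ([locally_lipschitz_along]).  Finally
    dt^2 is O(dt^(min ord 2)). *)

(** * The maximum norm on matrices and pairs *)

Lemma norm_entry_le {R : realType} {m n : nat} (A : 'M[R]_(m, n)) i j :
  `|A i j| <= `|A|.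
Proof.
rewrite [leRHS]/Num.Def.normr/= mx_normrE.
exact: (@le_bigmax _ _ _ _ (fun ij : 'I_m * 'I_n => `|A ij.1 ij.2|) (i, j)).
Qed.

Lemma mx_norm_le {R : realType} {m n : nat} (A : 'M[R]_(m, n)) (M : R) :
  0 <= M -> (forall i j, `|A i j| <= M) -> `|A| <= M.
Proof.
move=> M0 AM; rewrite [leLHS]/Num.Def.normr/= mx_normrE.
by rewrite bigmax_le// => -[i j] _ /=.
Qed.

Lemma norm_mulmx_le {R : realType} {m n q : nat}
    (A : 'M[R]_(m, n)) (B : 'M[R]_(n, q)) :
  `|A *m B| <= n%:R * (`|A| * `|B|).
Proof.
apply: mx_norm_le => [|i k]; first by rewrite !mulr_ge0.
rewrite mxE (le_trans (ler_norm_sum _ _ _))// mulr_natl.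
rewrite -[n in _ *+ n]card_ord -sumr_const ler_sum// => l _.
by rewrite normrM ler_pM// norm_entry_le.
Qed.

Lemma norm_trmx_le {R : realType} {m n : nat} (A : 'M[R]_(m, n)) :
  `|A^T| <= `|A|.
Proof. by apply: mx_norm_le => // i j; rewrite mxE norm_entry_le. Qed.

Lemma norm_pair_le {R : realType} {V W : normedModType R} (x : V * W) (M : R) :
  `|x.1| <= M -> `|x.2| <= M -> `|x| <= M.
Proof. by move=> x1 x2; rewrite [leLHS]/Num.Def.normr/= ge_max x1 x2. Qed.

(** * Local Lipschitz continuity *)

(** The norm is the maximum of the entries, so the scalar mean value theorem
    applies to each entry, with an intermediate point of its own. *)
Lemma mean_value_inequality {R : realType} {m n : nat}
    (phi : R -> 'M[R]_(m, n)) (M : R) :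
  (forall t, 0 <= t <= 1 -> derivable phi t 1 /\ `|'D_1 phi t| <= M) ->
  `|phi 1 - phi 0| <= M.
Proof.
move=> phiM; have M0 : 0 <= M.
  by have [|_] := phiM 0; [rewrite lexx ler01|exact: le_trans].
apply: mx_norm_le => // i j; rewrite !mxE.
have dij t : 0 <= t <= 1 -> derivable (fun t => phi t i j) t 1.
  by move=> /phiM[/derivable_mxP].
have [t||t t01 ->] := @MVT_segment R (fun t => phi t i j)
  (fun t => 'D_1 (fun t => phi t i j) t) 0 1 ler01.
- by rewrite in_itv/= => /andP[/ltW t0 /ltW t1]; apply/derivableP/dij/andP.
- by apply: derivable_within_continuous => t; rewrite in_itv/= => /dij.
have [dphi phit] := phiM t t01.
rewrite subr0 mulr1 (le_trans _ phit)// derive_mx//.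
by rewrite (le_trans _ (norm_entry_le _ i j))// mxE.
Qed.

(** The bound holds for all pairs in a neighbourhood of the diagonal point
    (x, x), that is, on some ball around x. *)
Definition locally_lipschitz {R : realType} {V W : normedModType R}
    (g : V -> W) :=
  forall x : V, exists k : R, k.-lipschitz_on g (nbhs (x, x)).

(** A ball is convex, so the mean value inequality applies along the segment
    joining any two of its points. *)
Lemma diff_bounded_lipschitz {R : realType} {V : normedModType R} {m n : nat}
    (g : V -> 'M[R]_(m, n)) (k : R) (x : V) :
  (\forall z \near x,
    differentiable g z /\ forall h, `|'d g z h| <= k * `|h|) ->
  k.-lipschitz_on g (nbhs (x, x)).
Proof.
move=> /nbhs_ballP[e /= e0 gk].
exists (ball x e, ball x e) => [|[z w] [/= xz xw]].
  by split; exact: nbhsx_ballx.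
pose c t : V := t *: (z - w) + w.
have dc t : is_diff t c (fun h => h *: (z - w)).
  have -> : c = ( *:%R ^~ (z - w)) + cst w by [].
  by apply: is_diff_eq; rewrite addr0.
have -> : g z - g w = (g \o c) 1 - (g \o c) 0.
  by rewrite /= /c scale1r scale0r add0r subrK.
apply: mean_value_inequality => t t01.
have [] : differentiable g (c t) /\ forall h, `|'d g (c t) h| <= k * `|h|.
  apply: gk; move: xz xw; rewrite -!ball_normE /= => xz xw.
  have -> : x - c t = t *: (x - z) + (1 - t) *: (x - w).
    rewrite !scalerBr addrACA -scalerDl -opprD subrKC scale1r; congr (_ - _).
    by rewrite /c scalerBr scalerBl scale1r -addrA [- _ + _]addrC.
  (* The open ball is convex: the bound t |x - z| < t e is strict unless t = 0,
     and then the other term is strictly below e. *)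
  case/andP: t01 => t0 t1; rewrite (le_lt_trans (ler_normD _ _))// !normrZ.
  rewrite (ger0_norm t0) (@ger0_norm _ (1 - t)) ?subr_ge0//.
  have le2 : (1 - t) * `|x - w| <= (1 - t) * e
    by rewrite ler_wpM2l// ?subr_ge0//; exact: ltW.
  have [->|tn0] := eqVneq t 0; first by rewrite mul0r add0r subr0 mul1r.
  have t_gt0 : 0 < t by rewrite lt_neqAle eq_sym tn0.
  have : t * `|x - z| < t * e by rewrite ltr_pM2l.
  by lra.
move=> dg gh; have dgc : differentiable (g \o c) t.
  exact: differentiable_comp.
split; first exact/derivable1_diffP.
rewrite deriveE// diff_comp//= (_ : 'd c t 1 = z - w) ?gh//.
by rewrite diff_val scale1r.
Qed.

Lemma C1_locally_lipschitz {R : realType} {m n : nat} (g : R -> 'M[R]_(m, n)) :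
  C1 g -> locally_lipschitz g.
Proof.
move=> [dg cg] x.
have [M gM] := (ex_bound _).1 (cvg_bounded _ _ (cg x)).
exists M; apply: diff_bounded_lipschitz; near=> z.
have dgz : differentiable g z by exact/derivable1_diffP.
split=> // h; rewrite diff1E// normrZ mulrC ler_wpM2r//.
by near: z.
Unshelve. all: by end_near. Qed.

(** A continuous directional derivative is bounded near each point.  The
    canonical basis has finitely many vectors, so their derivatives bound the
    whole differential near the point. *)
Lemma continuous_partials_locally_lipschitz {R : realType} {n m q : nat}
    (g : 'cV[R]_n * 'cV[R]_m -> 'cV[R]_q) :
  (forall x, differentiable g x) ->
  (forall v : 'cV[R]_n * 'cV[R]_m, continuous ('D_v g)) ->
  locally_lipschitz g.
Proof.
move=> dg cg x.
have bnd v : exists M, \forall z \near x, `|'D_v g z| <= M.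
  exact: (ex_bound _).1 (cvg_bounded _ _ (cg v x)).
have [M1 gM1] := choice (fun i => bnd (delta_mx i 0, 0)).
have [M2 gM2] := choice (fun i => bnd (0, delta_mx i 0)).
exists (\sum_i M1 i + \sum_i M2 i); apply: diff_bounded_lipschitz; near=> z.
split=> // h.
have z1 i : `|'d g z (delta_mx i 0, 0)| <= M1 i.
  rewrite -deriveE//; by move: i; near: z; apply: filter_forall.
have z2 i : `|'d g z (0, delta_mx i 0)| <= M2 i.
  rewrite -deriveE//; by move: i; near: z; apply: filter_forall.
have hE : h = \sum_i h.1 i 0 *: (delta_mx i 0, 0) +
              \sum_i h.2 i 0 *: (0, delta_mx i 0).
  have fst_sum k (F : 'I_k -> 'cV[R]_n * 'cV[R]_m) :
      (\sum_i F i).1 = \sum_i (F i).1 by apply: big_morph.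
  have snd_sum k (F : 'I_k -> 'cV[R]_n * 'cV[R]_m) :
      (\sum_i F i).2 = \sum_i (F i).2 by apply: big_morph.
  rewrite [LHS]surjective_pairing [RHS]surjective_pairing.
  congr (_, _); rewrite /= ?(fst_sum, snd_sum)/=.
    rewrite [X in _ + X]big1 ?addr0// => [|i _]; last by rewrite scaler0.
    by rewrite [LHS]matrix_sum_delta; apply: eq_bigr => i _; rewrite big_ord1.
  rewrite big1 ?add0r// => [|i _]; last by rewrite scaler0.
  by rewrite [LHS]matrix_sum_delta; apply: eq_bigr => i _; rewrite big_ord1.
rewrite [in leLHS]hE linearD !linear_sum/= (le_trans (ler_normD _ _))//.
rewrite mulrDl !mulr_suml.
have h1 i : `|h.1 i 0| <= `|h|.
  rewrite (le_trans (norm_entry_le _ _ _))//.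
  by rewrite [leRHS]/Num.Def.normr/= le_max lexx.
have h2 i : `|h.2 i 0| <= `|h|.
  rewrite (le_trans (norm_entry_le _ _ _))//.
  by rewrite [leRHS]/Num.Def.normr/= le_max lexx orbT.
rewrite lerD// (le_trans (ler_norm_sum _ _ _))// ler_sum// => i _.
  by rewrite linearZ normrZ mulrC ler_pM.
by rewrite linearZ normrZ mulrC ler_pM.
Unshelve. all: by end_near. Qed.

(** Near each time t there is a threshold beyond which every k is a Lipschitz
    constant on the balls of radius 1/k around the points of the curve.
    Compactness of [A, B] then gives one k for the whole curve. *)
Lemma locally_lipschitz_along {R : realType} {V W : normedModType R}
    (g : V -> W) (c : R -> V) (A B : R) :
  locally_lipschitz g -> continuous c ->
  exists k e, [/\ 0 < k, 0 < e &
    forall t, A <= t <= B -> k.-lipschitz_(ball (c t) e) g].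
Proof.
move=> gl cc.
have /compact_near_coveringP/(_ _ (+oo)
  (fun k t => k.-lipschitz_(ball (c t) k^-1) g)) H := @segment_compact R A B.
have /H : forall t, `[A, B]%classic t -> \forall t' \near t & k \near +oo,
    k.-lipschitz_(ball (c t') k^-1) g.
  move=> t _; have [k /nbhs_ballP[e /= e0 gk]] := gl (c t).
  have e20 : 0 < e / 2 by rewrite divr_gt0.
  near=> t' K => z /= [xz xw].
  have ct : ball (c t) (e / 2) (c t').
    by near: t'; apply: cc; exact: nbhsx_ballx.
  have K0 : 0 < K by near: K; exact: nbhs_pinfty_gt.
  have Ke : K^-1 <= e / 2.
    by rewrite invf_ple ?posrE//; near: K; exact: nbhs_pinfty_ge (num_real _).
  have kK : k <= K by near: K; exact: nbhs_pinfty_ge (num_real _).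
  rewrite (le_trans (gk _ _))//=; last by rewrite ler_wpM2r.
  split=> /=; rewrite [e]splitr; apply: ball_triangle ct _.
    exact: le_ball Ke _ xz.
  exact: le_ball Ke _ xw.
move=> HK; near (+oo : set_system R) => k.
exists k, k^-1; split; rewrite ?invr_gt0.
- by near: k; exact: nbhs_pinfty_gt.
- by near: k; exact: nbhs_pinfty_gt.
- by move=> t tAB; move: t {tAB} (tAB : `[A, B]%classic t); near: k.
Unshelve. all: by end_near. Qed.

Lemma partial_fstE {R : realType} {n m q : nat}
    (F : 'cV[R]_n * 'cV[R]_m -> 'cV[R]_q) (v : 'cV[R]_n)
    (x : 'cV[R]_n * 'cV[R]_m) :
  'D_v (fun z => F (z, x.2)) x.1 = 'D_(v, 0) F x.
Proof.
rewrite /derive; apply: (congr1 (fun g : R -> 'cV[R]_q => lim (g @ 0^'))).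
apply/funext => h /=.
rewrite -surjective_pairing; congr (_ *: (F _ - _)).
rewrite [RHS]surjective_pairing.
by congr (_, _) => /=; rewrite scaler0 add0r.
Qed.

(** The columns of f_y are directional derivatives of f on the product space,
    and their own directional derivatives are continuous because f is smooth. *)
Lemma f_y_locally_lipschitz {R : realType} {n m : nat}
    (f : 'cV[R]_n -> 'cV[R]_m -> 'cV[R]_n) :
  smooth (fun x : 'cV[R]_n * 'cV[R]_m => f x.1 x.2) ->
  locally_lipschitz (fun x : 'cV[R]_n * 'cV[R]_m => f_y f x.1 x.2).
Proof.
set F := fun x => _; move=> Fs x.
have gl (l : 'I_n) : exists k : R,
    k.-lipschitz_on ('D_(delta_mx l 0, 0) F) (nbhs (x, x)).
  apply: continuous_partials_locally_lipschitz => [z|v z].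
    exact: (Fs [:: (delta_mx l 0, 0)]).
  apply: differentiable_continuous.
  exact: (Fs [:: v; (delta_mx l 0, 0)]).
have [k gk] := choice gl.
exists (\sum_l `|k l|); rewrite /dominated_by/=; near=> z.
apply: mx_norm_le => [|i l]; first by rewrite mulr_ge0// sumr_ge0.
have -> : (f_y f z.1.1 z.1.2 - f_y f z.2.1 z.2.2) i l =
    ('D_(delta_mx l 0, 0) F z.1 - 'D_(delta_mx l 0, 0) F z.2) i 0.
  by rewrite !mxE -!partial_fstE.
rewrite (le_trans (norm_entry_le _ _ _))//.
apply: (@le_trans _ _ (k l * `|z.1 - z.2|)).
  by move: l; near: z; apply: filter_forall.
rewrite ler_wpM2r// (le_trans (ler_norm _))// (bigD1 l)//= lerDl.
by rewrite sumr_ge0.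
Unshelve. all: by end_near. Qed.

(** * Comparison of the two update formulas *)

(** Once the BDF condition has reduced both formulas to one Jacobian term, this
    is what remains: P is p_i, S is (A^t p)_i, and A and B are the Jacobians
    used by the first and by the second formula. *)
Lemma update_algebra {R : realType} {n : nat} (dt c : R) (P S : 'cV[R]_n)
    (A B : 'M[R]_n) :
  (P^T + S^T - dt *: ((c *: P)^T *m A))^T -
    (P - (- S + dt *: (c *: (B^T *m P)))) =
  (dt * c) *: ((B - A)^T *m P).
Proof.
have -> : (P^T + S^T - dt *: ((c *: P)^T *m A))^T =
    P + S - dt *: (c *: (A^T *m P)).
  rewrite -[P + S]trmxK [(P + S)^T]linearD [LHS]linearB; congr (_ - _).
  by rewrite [LHS]linearZ/= trmx_mul trmxK -scalemxAr.
have -> : (B - A)^T *m P = B^T *m P - A^T *m P.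
  by rewrite -mulmxBl; congr (_ *m _); exact: linearB.
move: (B^T *m P) (A^T *m P) => X Y.
by apply/colP => l; rewrite !mxE; ring.
Qed.

(** The derivative of j(y_N) in y_i is that of a constant, since i < N; and only
    the summand with coefficient b_{-1} survives in either sum over b. *)
Lemma dto_otd {R : realType} {n m s : nat} (a : nat -> R) (b : int -> R)
    (f : 'cV[R]_n -> 'cV[R]_m -> 'cV[R]_n) (j : 'cV[R]_n -> R)
    (dt : R) (N : nat) (y : int -> 'cV[R]_n) (u : int -> 'cV[R]_m)
    (p : int -> 'cV[R]_n) (d i : int) :
  bdf_type s b -> i < N%:Z ->
  (dto s a b f j dt N y u p i)^T - otd s a b d f dt y u p (i + 1) =
  (dt * b (-1)) *:
    ((f_y f (y (i - d)) (u (i - d)) - f_y f (y i) (u i))^T *m p i).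
Proof.
move=> [b0 _] iN.
rewrite /dto (_ : d_yi_jN j N y i = 0); last first.
  apply/rowP => l; rewrite !mxE /=.
  under [X in 'D__ X _]eq_fun do rewrite (gt_eqF iN).
  exact: derive_cst.
have bsum0 (F : nat -> 'cV[R]_n) :
    \sum_(k < s.+1) b (k%:Z - 1) *: F k = b (-1) *: F 0%N.
  rewrite big_ord_recl/= sub0r big1 ?addr0// => k _.
  by rewrite /bump leq0n add1n intS addrAC subrr add0r b0// scale0r.
rewrite /otd /Bt (bsum0 (fun k => p (i + 1 + (k%:Z - 1)))).
rewrite (bsum0 (fun k => (f_y f (y (i + 1 + (k%:Z - 1) - d))
  (u (i + 1 + (k%:Z - 1) - d)))^T *m p (i + 1 + (k%:Z - 1)))).
rewrite sub0r addrK addr0.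
exact: update_algebra.
Qed.

(** * Uniform estimates on the grid *)

Lemma near_step_lt {R : realType} (T e : R) :
  0 < T -> 0 < e -> \forall N \near \oo, 0 < step T N < e.
Proof.
move=> T0 e0; near=> N.
have N0 : 0 < N%:R :> R by rewrite ltr0n; near: N; exact: nbhs_infty_gt.
rewrite /step divr_gt0//= ltr_pdivrMr// mulrC -ltr_pdivrMr//.
by near: N; apply: nbhs_infty_gtr.
Unshelve. all: by end_near. Qed.

Lemma unifO_ge0 {R : realType} {V : normedModType R} {T : R} {q : nat}
    {lo : int} {hi : nat -> int} {e : nat -> int -> V} :
  0 < T -> unifO T q lo hi e ->
  exists2 C, 0 <= C & \forall N \near \oo, forall k : int, lo <= k <= hi N ->
    `|e N k| <= C * step T N ^+ q.
Proof.
move=> T0 [C eC]; exists `|C| => //; near=> N => k klh.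
have /andP[dt0 _] : 0 < step T N < 1.
  by near: N; apply: near_step_lt.
rewrite (@le_trans _ _ (C * step T N ^+ q))//.
  by move: k klh; near: N.
by rewrite ler_wpM2r ?exprn_ge0 ?ler_norm// ltW.
Unshelve. all: by end_near. Qed.

Lemma unifO_leq {R : realType} {V : normedModType R} {T : R} {q q' : nat}
    {lo : int} {hi : nat -> int} {e : nat -> int -> V} :
  0 < T -> (q' <= q)%N -> unifO T q lo hi e -> unifO T q' lo hi e.
Proof.
move=> T0 q'q /(unifO_ge0 T0)[C C0 eC]; exists C; near=> N => k klh.
have /andP[dt0 dt1] : 0 < step T N < 1.
  by near: N; apply: near_step_lt.
rewrite (@le_trans _ _ (C * step T N ^+ q))//.
  by move: k klh; near: N.
by rewrite ler_wpM2l// ler_wiXn2l// ltW.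
Unshelve. all: by end_near. Qed.

(** Joins the accuracy of the starting values to that of the computed ones. *)
Lemma unifO_cat {R : realType} {V : normedModType R} {T : R} {q : nat}
    {lo mid : int} {hi : nat -> int} {e : nat -> int -> V} :
  0 < T -> unifO T q lo (fun=> mid) e -> unifO T q (mid + 1) hi e ->
  unifO T q lo hi e.
Proof.
move=> T0 /(unifO_ge0 T0)[C C0 eC] /(unifO_ge0 T0)[D D0 eD].
exists (C + D); near=> N => k /andP[lok khi].
have /andP[dt0 _] : 0 < step T N < 1.
  by near: N; apply: near_step_lt.
have dtq : 0 <= step T N ^+ q by rewrite exprn_ge0// ltW.
have [kmid|midk] := lerP k mid.
  rewrite (@le_trans _ _ (C * step T N ^+ q))//; last first.
    by rewrite ler_wpM2r// lerDl.
  suff : lo <= k <= mid by move: k {lok khi kmid}; near: N.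
  exact/andP.
rewrite (@le_trans _ _ (D * step T N ^+ q))//; last first.
  by rewrite ler_wpM2r// lerDr.
suff : mid + 1 <= k <= hi N by move: k {lok khi midk}; near: N.
by rewrite khi andbT lezD1.
Unshelve. all: by end_near. Qed.

Lemma grid_bounds {R : realType} {s : nat} {T : R} {N : nat} {k : int} :
  0 < T -> (0 < N)%N -> 1 - s%:Z <= k <= N%:Z ->
  - (s%:R * T) <= k%:~R * step T N <= T.
Proof.
move=> T0 N0 /andP[sk kN].
have NR : 1 <= N%:R :> R by rewrite ler1n.
have dt0 : 0 < step T N by rewrite divr_gt0// (lt_le_trans ltr01).
have dtT : step T N <= T.
  by rewrite ler_pdivrMr ?ler_peMr ?(lt_le_trans ltr01)// ltW.
apply/andP; split.
  rewrite (@le_trans _ _ (- s%:R * step T N))//.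
    by rewrite mulNr lerN2 ler_wpM2l.
  rewrite ler_pM2r// -[_%:R]/((s%:Z)%:~R) -rmorphN ler_int.
  by rewrite (le_trans _ sk)// lerDr.
rewrite (@le_trans _ _ (N%:Z%:~R * step T N))//.
  by rewrite ler_pM2r// ler_int.
by rewrite /step -[N%:~R]/(N%:R) mulrC divfK// gt_eqF// (lt_le_trans ltr01).
Qed.

(** The grid times, including the negative ones, lie in the compact interval
    [-sT, T], on which g has a uniform local Lipschitz constant. *)
Lemma C1_consecutive {R : realType} {n : nat} {T : R} (s : nat)
    {g : R -> 'cV[R]_n} :
  0 < T -> C1 g ->
  unifO T 1 (2 - s%:Z) (fun N => N%:Z)
    (fun N k => g ((k - 1)%:~R * step T N) - g (k%:~R * step T N)).
Proof.
move=> T0 /C1_locally_lipschitz gl.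
have cid : continuous (id : R -> R) by move=> ?; exact: cvg_id.
have [L [r [L0 r0 gL]]] :=
  locally_lipschitz_along _ id (- (s%:R * T)) T gl cid.
exists L; near=> N => k /andP[sk kN].
have N0 : (0 < N)%N by near: N; exact: nbhs_infty_gt.
have /andP[dt0 dtr] : 0 < step T N < r.
  by near: N; apply: near_step_lt.
have kb : - (s%:R * T) <= k%:~R * step T N <= T.
  by apply: grid_bounds => //; rewrite kN andbT (le_trans _ sk)// lerD2r.
have tE : (k - 1)%:~R * step T N = k%:~R * step T N - step T N.
  by rewrite rmorphB/= mulrBl mul1r.
rewrite tE expr1; move: (k%:~R * step T N) kb => t tb.
have t'r : ball t r (t - step T N).
  by rewrite -ball_normE/= opprB subrKC gtr0_norm.
apply: (le_trans (gL t tb (t - step T N, t) (conj t'r (ballxx _ r0)))) => /=.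
by rewrite addrAC subrr add0r normrN gtr0_norm.
Unshelve. all: by end_near. Qed.

(** Writing z_k for the discrete values (yd_k, ud_k) and c for the continuous
    curve (y, u), both z_{k-1} and z_k are within (D + L) dt of c(t_k), where D
    is the approximation constant and L the Lipschitz constant of c.  For small
    dt they lie in the ball around c(t_k) on which f_y is Lipschitz. *)
Lemma f_y_consecutive {R : realType} {n m s : nat} {T : R}
    {f : 'cV[R]_n -> 'cV[R]_m -> 'cV[R]_n}
    {y : R -> 'cV[R]_n} {u : R -> 'cV[R]_m}
    {yd : nat -> int -> 'cV[R]_n} {ud : nat -> int -> 'cV[R]_m} :
  0 < T -> smooth (fun x : 'cV[R]_n * 'cV[R]_m => f x.1 x.2) -> C1 y -> C1 u ->
  unifO T 1 (1 - s%:Z) (fun N => N%:Z)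
    (fun N k => yd N k - y (k%:~R * step T N)) ->
  unifO T 1 (1 - s%:Z) (fun N => N%:Z)
    (fun N k => ud N k - u (k%:~R * step T N)) ->
  unifO T 1 (2 - s%:Z) (fun N => N%:Z)
    (fun N k => f_y f (yd N (k - 1)) (ud N (k - 1)) - f_y f (yd N k) (ud N k)).
Proof.
move=> T0 fs yC1 uC1 /(unifO_ge0 T0)[Cy Cy0 ydC] /(unifO_ge0 T0)[Cu Cu0 udC].
have [Ly Ly0 yL] := unifO_ge0 T0 (C1_consecutive s T0 yC1).
have [Lu Lu0 uL] := unifO_ge0 T0 (C1_consecutive s T0 uC1).
have cont q (g : R -> 'cV[R]_q) : C1 g -> continuous g.
  by move=> [dg _] t; apply/differentiable_continuous/derivable1_diffP/dg.
pose c t := (y t, u t).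
have cc : continuous c.
  by move=> t; exact: (cvg_pair (cont _ _ yC1 t) (cont _ _ uC1 t)).
have [K [r [K0 r0 fK]]] := locally_lipschitz_along _ c (- (s%:R * T)) T
  (f_y_locally_lipschitz f fs) cc.
pose D := Cy + Cu; pose L := Ly + Lu.
have D0 : 0 <= D by exact: addr_ge0.
have L0 : 0 <= L by exact: addr_ge0.
have DL0 : 0 < D + L + 1 by rewrite ltr_wpDl// addr_ge0.
(* The distance from z_{k-1} to z_k is at most (D + L) dt + D dt, through
   c(t_k). *)
exists (K * (D + (D + L))); near=> N => k /andP[sk kN].
have N0 : (0 < N)%N by near: N; exact: nbhs_infty_gt.
have /andP[dt0 dtr] : 0 < step T N < r / (D + L + 1).
  by near: N; apply: near_step_lt => //; rewrite divr_gt0.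
have ydN l : 1 - s%:Z <= l <= N%:Z ->
    `|yd N l - y (l%:~R * step T N)| <= Cy * step T N ^+ 1.
  by move: l; near: N.
have udN l : 1 - s%:Z <= l <= N%:Z ->
    `|ud N l - u (l%:~R * step T N)| <= Cu * step T N ^+ 1.
  by move: l; near: N.
have skN : 2 - s%:Z <= k <= N%:Z by rewrite sk.
have yLN : `|y ((k - 1)%:~R * step T N) - y (k%:~R * step T N)| <=
    Ly * step T N ^+ 1.
  by move: k skN {sk kN}; near: N.
have uLN : `|u ((k - 1)%:~R * step T N) - u (k%:~R * step T N)| <=
    Lu * step T N ^+ 1.
  by move: k skN {sk kN yLN}; near: N.
have tb : 1 - s%:Z <= k <= N%:Z -> _ := grid_bounds T0 N0.
move: (step T N) dt0 dtr ydN udN yLN uLN tb => dt dt0 dtr ydN udN yLN uLN tb.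
rewrite !expr1 in ydN udN yLN uLN *.
set t := k%:~R * dt; set t' := (k - 1)%:~R * dt.
have kin : 1 - s%:Z <= k <= N%:Z.
  by rewrite kN andbT (le_trans _ sk)// lerD2r.
have k1in : 1 - s%:Z <= k - 1 <= N%:Z.
  by rewrite lerBrDr addrAC sk/= (le_trans _ kN)// lerBlDr lerDl.
pose z l : 'cV[R]_n * 'cV[R]_m := (yd N l, ud N l).
have zc l : 1 - s%:Z <= l <= N%:Z -> `|z l - c (l%:~R * dt)| <= D * dt.
  move=> lin; apply: norm_pair_le => /=.
    by rewrite (le_trans (ydN _ lin))// ler_pM2r// lerDl.
  by rewrite (le_trans (udN _ lin))// ler_pM2r// lerDr.
have ct : `|c t' - c t| <= L * dt.
  apply: norm_pair_le => /=.
    by rewrite (le_trans yLN)// ler_pM2r// lerDl.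
  by rewrite (le_trans uLN)// ler_pM2r// lerDr.
have zk : `|z k - c t| <= D * dt by exact: zc.
have zk1 : `|z (k - 1) - c t| <= (D + L) * dt.
  rewrite -(subrKA (c t')) (le_trans (ler_normD _ _))// mulrDl lerD//.
  exact: zc.
have DLr : (D + L) * dt < r.
  rewrite (@lt_trans _ _ ((D + L + 1) * dt))//.
    by rewrite ltr_pM2r// ltrDl.
  by rewrite mulrC -ltr_pdivlMr.
apply: (le_trans (fK t (tb kin) (z (k - 1), z k) _)) => /=.
  split; rewrite -ball_normE /= distrC; first exact: le_lt_trans zk1 _.
  by rewrite (le_lt_trans zk)// (le_lt_trans _ DLr)// ler_pM2r// lerDl.
rewrite -mulrA ler_pM2l// -(subrKA (c t)) (le_trans (ler_normD _ _))//.
by rewrite addrC mulrDl lerD// distrC.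
Unshelve. all: by end_near. Qed.

Theorem lemma2p3 (R : realType) (n m s ord : nat)
  (f : 'cV[R]_n -> 'cV[R]_m -> 'cV[R]_n) (j : 'cV[R]_n -> R)
  (T : R) (y0 : 'cV[R]_n)
  (y : R -> 'cV[R]_n) (u : R -> 'cV[R]_m) (p : R -> 'cV[R]_n)
  (a : nat -> R) (b : int -> R)
  (yd : nat -> int -> 'cV[R]_n) (ud : nat -> int -> 'cV[R]_m)
  (pd : nat -> int -> 'cV[R]_n)
  (hs : (0 < s)%N) (hord : (0 < ord)%N) (hT : 0 < T)
  (f_smooth : smooth (fun x : 'cV[R]_n * 'cV[R]_m => f x.1 x.2))
  (j_smooth : smooth j)
  (yu_optimal : optimal f j T y0 y u)
  (yup_adjoint : adjoint_conditions f j T y u p)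
  (y_regular : C1 y) (u_regular : C1 u)
  (bdf : bdf_type s b)
  (scheme : \forall N \near \oo,
    multistep s a b f (step T N) N (yd N) (ud N))
  (start_consistent : unifO T ord (1 - s%:Z) (fun=> 0)
    (fun N k => yd N k - y (k%:~R * step T N)))
  (order_ord : unifO T ord 1 (fun N => N%:Z)
    (fun N k => yd N k - y (k%:~R * step T N)))
  (ud_approx : unifO T 1 (1 - s%:Z) (fun N => N%:Z)
    (fun N k => ud N k - u (k%:~R * step T N)))
  (pd_bounded : unifO T 0 (1 - s%:Z) (fun N => N%:Z) pd) :
  unifO T ord (1 - s%:Z) (fun N => N%:Z - s%:Z)
    (fun N i =>
       (dto s a b f j (step T N) N (yd N) (ud N) (pd N) i)^T -
       otd s a b 0 f (step T N) (yd N) (ud N) (pd N) (i + 1)) /\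
  unifO T (minn ord 2) (2 - s%:Z) (fun N => N%:Z - s%:Z)
    (fun N i =>
       (dto s a b f j (step T N) N (yd N) (ud N) (pd N) i)^T -
       otd s a b 1 f (step T N) (yd N) (ud N) (pd N) (i + 1)).
Proof.
split.
  (* With d = 0 both Jacobians are taken at the same point. *)
  exists 0; near=> N => i /andP[_ iNs]; rewrite mul0r dto_otd//.
    by rewrite subr0 subrr trmx0 mul0mx scaler0 normr0.
  by rewrite (le_lt_trans iNs)// ltrBlDr ltrDl ltz_nat.
have yd_approx : unifO T 1 (1 - s%:Z) (fun N => N%:Z)
    (fun N k => yd N k - y (k%:~R * step T N)).
  by apply: unifO_leq hord _ => //; exact: unifO_cat start_consistent order_ord.
have [C C0 fC] := unifO_ge0 hT
  (f_y_consecutive hT f_smooth y_regular u_regular yd_approx ud_approx).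
have [P P0 pP] := unifO_ge0 hT pd_bounded.
(* The proof gives dt^2, whatever the order; the exponent is then lowered. *)
apply: (@unifO_leq _ _ _ 2) => //; first exact: geq_minr.
exists (`|b (-1)| * (n%:R * (C * P))); near=> N => i /andP[si iNs].
have iN : i < N%:Z by rewrite (le_lt_trans iNs)// ltrBlDr ltrDl ltz_nat.
rewrite dto_otd// normrZ; set A := f_y _ _ _ - _.
have /andP[dt0 _] : 0 < step T N < 1 by near: N; apply: near_step_lt.
have AC : `|A| <= C * step T N.
  have : 2 - s%:Z <= i <= N%:Z by rewrite si ltW.
  rewrite -[X in _ * X]expr1 /A; move: (i); near: N; exact: fC.
have piP : `|pd N i| <= P.
  have : 1 - s%:Z <= i <= N%:Z.
    by rewrite (ltW iN) andbT (le_trans _ si)// lerD2r.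
  rewrite -[P]mulr1 -[X in _ * X](expr0 (step T N)); move: (i); near: N.
  exact: pP.
move: (step T N) dt0 AC => dt dt0 AC.
rewrite normrM (gtr0_norm dt0) expr2.
have -> : `|b (-1)| * (n%:R * (C * P)) * (dt * dt) =
  dt * `|b (-1)| * (n%:R * (C * dt * P)) by ring.
apply: ler_wpM2l; first by rewrite mulr_ge0// ltW.
rewrite (le_trans (norm_mulmx_le _ _))// ler_wpM2l// ler_pM//.
by rewrite (le_trans (norm_trmx_le _)).
Unshelve. all: by end_near. Qed.
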